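(* Let $k\ge 1$ and let $\bm{p}=(p_1,\ldots,p_k)$ be a vector of non-negative integers with $p_{\max}\le 2p_{\min}$, where $p_{\min}=\min\{p_1,\ldots,p_k\}$ and $p_{\max}=\max\{p_1,\ldots,p_k\}$. Then \textsc{$L(\bm{p})$-Labeling} restricted to connected graphs of diameter at most $k$ can be reduced to \textsc{Metric Path TSP} in $O(nm)$ time. Precisely: given a connected graph $G=(V,E)$ with $n$ vertices, $m$ edges and diameter at most $k$, one can in $O(nm)$ time construct the edge-weighted complete graph $H$ on vertex set $V$ with weight $w(u,v)=p_{\mathrm{dist}_G(u,v)}$ for every pair of distinct $u,v\in V$; these weights satisfy the triangle inequality, and the minimum total weight of a Hamiltonian path in $H$ equals $\lambda_{\bm{p}}(G)$.
   Context: Graphs are finite, simple, undirected and connected; $\mathrm{dist}_G(u,v)$ is the length of a shortest $u$–$v$ path and the diameter is the maximum distance over all vertex pairs. For a graph $G=(V,E)$ and a vector $\bm{p}=(p_1,\ldots,p_k)$ of non-negative integers, a mapping $l:V\to\mathbb{N}\cup\{0\}$ is an $L(\bm{p})$-labeling of $G$ if $|l(u)-l(v)|\ge p_d$ for any two distinct vertices $u,v$ with $\mathrm{dist}_G(u,v)=d\le k$. The span of $l$ is $\max_{v\in V} l(v)$. \textsc{$L(\bm{p})$-Labeling} asks for the minimum span $\lambda_{\bm{p}}(G)$ of an $L(\bm{p})$-labeling of $G$. \textsc{Path TSP}: given an edge-weighted complete graph, find a Hamiltonian path of minimum total weight; \textsc{Metric Path TSP} is its restriction to instances whose edge weights satisfy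 the triangle inequality. *)

(* Defs.v *)
From mathcomp Require Import all_boot all_order all_algebra.

Set Implicit Arguments.
Unset Strict Implicit.
Unset Printing Implicit Defensive.

Section Graphs.
Variables (T : finType) (e : rel T).

Definition simple_graph : Prop := symmetric e /\ irreflexive e.

Definition connected_graph : Prop :=
  0 < #|T| /\ forall u v : T, connect e u v.

Definition edges : {set {set T}} := [set [set x.1; x.2] | x : T * T & e x.1 x.2].

Definition path_of_length (d : nat) (u v : T) : bool :=
  [exists s : d.-tuple T, [&& path e u s, uniq (u :: s) & last u s == v]].

(* A path has at most #|T| - 1 edges; the value is #|T| if there is no path. *)
Definition dist (u v : T) : nat :=
  \big[minn/#|T|]_(d < #|T| | path_of_length d u v) d.

Definition diameter : nat := \max_(u : T) \max_(v : T) dist u v.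

End Graphs.

Definition minimum_of (S : nat -> Prop) (m : nat) : Prop :=
  S m /\ forall s, S s -> m <= s.

(* The vector is indexed from 1: [entry p d] is p_d, stored at position d - 1. *)
Definition entry (p : seq nat) (d : nat) : nat := nth 0 p d.-1.

Definition pmax (p : seq nat) : nat := \max_(x <- p) x.
Definition pmin (p : seq nat) : nat := \big[minn/head 0 p]_(x <- p) x.

Section Labelings.
Variables (k : nat) (p : k.-tuple nat) (T : finType) (e : rel T).

Definition labeling (l : T -> nat) : Prop :=
  forall u v : T, u != v -> dist e u v <= k ->
    entry p (dist e u v) <= `|l u - l v|%N.

Definition label_span (l : T -> nat) : nat := \max_(v : T) l v.

Definition is_lambda (s : nat) : Prop :=
  minimum_of (fun s' => exists2 l, labeling l & label_span l = s') s.

End Labelings.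

(* A weighted complete graph on [T] is a function [w : T -> T -> nat], of which
   only the values at pairs of distinct vertices are meaningful. *)

Section PathTSP.
Variables (T : finType) (w : T -> T -> nat).

Definition weighted_complete_graph : Prop :=
  forall u v : T, u != v -> w u v = w v u.

Definition triangle_inequality : Prop :=
  forall u v x : T, u != v -> u != x -> v != x -> w u v <= w u x + w x v.

(* In a complete graph a Hamiltonian path is an ordering of the vertices. *)
Definition hamiltonian_path (s : seq T) : Prop := uniq s /\ forall v, v \in s.

Definition path_weight (s : seq T) : nat :=
  if s is x :: s' then sumn (pairmap w x s') else 0.

Definition is_min_path_tsp (s : nat) : Prop :=
  minimum_of (fun s' => exists2 c, hamiltonian_path c & path_weight c = s') s.

End PathTSP.

Definition dist_weight k (p : k.-tuple nat) (T : finType) (e : rel T)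
    (u v : T) : nat :=
  entry p (dist e u v).

(* Running times are those of structured programs for a unit-cost RAM, whose
   registers and array cells hold natural numbers. Arithmetic is addition and
   truncated subtraction only: with unit-cost multiplication the model would be
   unreasonably powerful. *)

Definition reg := nat.
Definition array := nat.

Record state := State {
  regs : reg -> nat;
  arrs : array -> nat -> nat
}.

Inductive cmd :=
  | Const of reg & nat          (* x := c *)
  | Add of reg & reg & reg      (* x := y + z *)
  | Sub of reg & reg & reg      (* x := y - z *)
  | Read of reg & array & reg   (* x := a[y] *)
  | Write of array & reg & reg  (* a[x] := y *)
  | Skip
  | Seq of cmd & cmd
  | If of reg & cmd & cmd       (* if x > 0 *)
  | While of reg & cmd.         (* while x > 0 *)

Definition set_reg (s : state) (x : reg) (v : nat) : state :=
  State (fun y => if y == x then v else regs s y) (arrs s).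

Definition set_cell (s : state) (a : array) (i v : nat) : state :=
  State (regs s)
    (fun b j => if (b == a) && (j == i) then v else arrs s b j).

(* [exec c s t s']: from state [s], [c] halts in state [s'] after [t] steps;
   every elementary instruction and every test is one step. *)
Inductive exec : cmd -> state -> nat -> state -> Prop :=
  | ExecConst x c s : exec (Const x c) s 1 (set_reg s x c)
  | ExecAdd x y z s :
      exec (Add x y z) s 1 (set_reg s x (regs s y + regs s z))
  | ExecSub x y z s :
      exec (Sub x y z) s 1 (set_reg s x (regs s y - regs s z))
  | ExecRead x a y s :
      exec (Read x a y) s 1 (set_reg s x (arrs s a (regs s y)))
  | ExecWrite a x y s :
      exec (Write a x y) s 1 (set_cell s a (regs s x) (regs s y))
  | ExecSkip s : exec Skip s 1 s
  | ExecSeq c1 c2 s t1 s1 t2 s2 :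
      exec c1 s t1 s1 -> exec c2 s1 t2 s2 -> exec (Seq c1 c2) s (t1 + t2) s2
  | ExecIfTrue x c1 c2 s t s1 :
      0 < regs s x -> exec c1 s t s1 -> exec (If x c1 c2) s t.+1 s1
  | ExecIfFalse x c1 c2 s t s1 :
      regs s x = 0 -> exec c2 s t s1 -> exec (If x c1 c2) s t.+1 s1
  | ExecWhileFalse x c s : regs s x = 0 -> exec (While x c) s 1 s
  | ExecWhileTrue x c s t1 s1 t2 s2 :
      0 < regs s x -> exec c s t1 s1 -> exec (While x c) s1 t2 s2 ->
      exec (While x c) s (t1 + t2).+1 s2.

Section Encoding.
Variables (T : finType) (e : rel T).

(* Each neighbour is listed once; the lists may be in any order. *)
Definition adjacency_lists (adj : T -> seq T) : Prop :=
  forall u, uniq (adj u) /\ adj u =i e u.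

(* The vertices are numbered 0, ..., #|T| - 1 by [enum_rank]. *)
Definition numbered_adjacency (adj : T -> seq T) : seq (seq nat) :=
  [seq [seq nat_of_ord (enum_rank v) | v <- adj u] | u <- enum T].

(* The neighbours of vertex i occupy cells offsets[i], ..., offsets[i + 1] - 1
   of the concatenation of all the adjacency lists. *)
Definition offsets (adj : T -> seq T) : seq nat :=
  0 :: scanl addn 0 (shape (numbered_adjacency adj)).

(* Registers 0 and 1 hold n and k; arrays 0, 1 and 2 hold the offsets, the
   concatenated adjacency lists and the vector; everything else is 0. *)
Definition input k (p : k.-tuple nat) (adj : T -> seq T) : state :=
  State (fun x => nth 0 [:: #|T|; k] x)
    (fun a i =>
       nth 0 (nth [::] [:: offsets adj; flatten (numbered_adjacency adj);
                          tval p] a) i).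

(* Array 3 holds the weight matrix, row by row, with an arbitrary diagonal. *)
Definition outputs (s : state) (w : T -> T -> nat) : Prop :=
  forall u v : T, u != v -> arrs s 3 (enum_rank u * #|T| + enum_rank v) = w u v.

End Encoding.

(* Main.v *)
Require Import Defs.
From mathcomp Require Import all_boot all_order all_algebra zify.

Set Implicit Arguments.
Unset Strict Implicit.
Unset Printing Implicit Defensive.

(* All weights lie between pmin and 2 pmin, which gives the triangle inequality.
   Sorting the vertices by label turns a labeling into a Hamiltonian path whose
   weight is at most the span. Conversely, labeling each vertex of a Hamiltonian
   path by the weight of the prefix ending there is admissible: consecutive
   labels differ by exactly the weight, all others by at least 2 pmin >= pmax.
   The distances are computed by a single breadth-first search in n disjoint
   copies of the graph, started from the vertex s of the s-th copy for all s at
   once; it makes O(n (n + m)) steps, which is O(n m) by connectedness. *)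

(** * Distances and shortest walks *)

Section Distance.
Variables (T : finType) (e : rel T).

(** Cutting the cycles out of a walk leaves a path on distinct vertices, so its length is below
    [#|T|] and is one of the indices of the minimum defining [dist]. *)
Lemma dist_le (u v : T) (s : seq T) :
  path e u s -> last u s = v -> dist e u v <= size s.
Proof.
move=> us <-; case/shortenP: us => s' us' uniq_s' sub_s'.
have ltT : size s' < #|T| by have := max_card (mem (u :: s')); rewrite (card_uniqP uniq_s').
have leS : size s' <= size s.
  by case/andP: uniq_s' => _ uniq_s'; apply: uniq_leq_size.
have: dist e u (last u s') <= Ordinal ltT.
  rewrite /dist -minEnat -leEnat; apply: Order.TotalTheory.bigmin_le_cond.
  by apply/existsP; exists (in_tuple s'); rewrite us' uniq_s' eqxx.
by move/leq_trans; apply.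
Qed.

Lemma dist_path (u v : T) : connect e u v ->
  exists s, [/\ path e u s, last u s = v & size s = dist e u v].
Proof.
case/connectP=> s us ->; case/shortenP: us => s' us' uniq_s' _.
have ltT : size s' < #|T| by have := max_card (mem (u :: s')); rewrite (card_uniqP uniq_s').
(* The minimum is at most [size s'], hence below the default [#|T|], so some path attains it. *)
have := dist_le us' erefl; rewrite /dist.
elim/big_ind: _ => [|x y IHx IHy|d /existsP[t /and3P[ut _ /eqP lt]] _].
- by rewrite leqNgt ltT.
- by rewrite /minn; case: ifP.
- by exists t; rewrite size_tuple.
Qed.

Lemma dist_xx (u : T) : dist e u u = 0.
Proof. by apply/eqP; rewrite -leqn0; apply: (@dist_le u u [::]). Qed.

Hypothesis conn : forall u v : T, connect e u v.

Lemma dist_eq0 (u v : T) : (dist e u v == 0) = (u == v).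
Proof.
apply/eqP/eqP=> [|->]; last exact: dist_xx.
by have [s [_ <- <-]] := dist_path (conn u v); case: s.
Qed.

Lemma dist_step (u x y : T) : e x y -> dist e u y <= (dist e u x).+1.
Proof.
move=> exy; have [s [us us_x <-]] := dist_path (conn u x).
rewrite -(size_rcons s y); apply: dist_le; last exact: last_rcons.
by rewrite rcons_path us us_x.
Qed.

(** The witness is the penultimate vertex of a shortest path. *)
Lemma dist_pred (u y : T) : dist e u y != 0 ->
  exists2 x, e x y & (dist e u x).+1 = dist e u y.
Proof.
have [s [us us_y szs]] := dist_path (conn u y).
case/lastP: s us us_y szs => [|s z]; first by move=> _ _ <-.
rewrite rcons_path last_rcons size_rcons => /andP[us usz] ez szs _.
subst z; exists (last u s) => //; apply/eqP; rewrite eqn_leq dist_step // andbT.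
by rewrite -szs ltnS dist_le.
Qed.

Lemma dist_sym (u v : T) : symmetric e -> dist e u v = dist e v u.
Proof.
move=> sym; wlog suff: u v / dist e v u <= dist e u v.
  by move=> H; apply/eqP; rewrite eqn_leq !H.
have [s [us <- <-]] := dist_path (conn u v).
have -> : size s = size (rev (belast u s)) by rewrite size_rev size_belast.
apply: dist_le; last by case: s {us} => //= x s; rewrite rev_cons last_rcons.
by rewrite rev_path; apply: sub_path us => x y; rewrite sym.
Qed.

Lemma dist_diameter (u v : T) : dist e u v <= diameter e.
Proof.
apply: (@leq_trans (\max_(v : T) dist e u v)).
  exact: (@leq_bigmax_cond _ _ (fun v => dist e u v)).
exact: (@leq_bigmax_cond _ _ (fun u => \max_(v : T) dist e u v)).
Qed.

End Distance.

(** * Bounds on the entries of the vector *)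

Lemma entry_le_pmax (p : seq nat) d : 0 < d <= size p -> entry p d <= pmax p.
Proof.
case: d => // d /= ltd; rewrite /entry /pmax /=.
exact: (@leq_bigmax_seq _ p xpredT id _ (mem_nth 0 ltd)).
Qed.

Lemma pmin_le_entry (p : seq nat) d : 0 < d <= size p -> pmin p <= entry p d.
Proof.
case: d => // d /= ltd; rewrite /entry /pmin /=.
(* The initial value of the minimum is generalised, since the head changes along the induction. *)
elim: p (head 0 p) d ltd => // x p IHp x0 [|d] /= ltd; rewrite big_cons geq_min ?leqnn //.
by rewrite IHp ?orbT.
Qed.

(** * Labelings and Hamiltonian paths *)

Section Metric.
Variables (T : finType) (w : T -> T -> nat).

(** Hamiltonian paths are the duplicate-free [#|T|]-tuples. These form a finite type, so attaining a
    given weight is decidable and a least weight can be selected. *)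
Lemma exists_min_path_tsp : exists m, is_min_path_tsp w m.
Proof.
pose P m := [exists c : #|T|.-tuple T, uniq c && (path_weight w c == m)].
have exP : exists m, P m.
  exists (path_weight w (enum T)); apply/existsP.
  by exists (enum_tuple T); rewrite /= enum_uniq eqxx.
case: (ex_minnP exP) => m /existsP[c /andP[uc /eqP wc]] min_m; exists m; split.
  exists c => //; split=> // v.
  have /subset_cardP : #|c| = #|T| by rewrite (card_uniqP uc) size_tuple.
  by move=> /(_ (subset_predT _)) ->.
move=> s [c' [uc' inc'] <-]; apply: min_m; apply/existsP.
have sz : size c' == #|T|.
  by rewrite -(card_uniqP uc'); apply/eqP/eq_card => v; rewrite inc'.
by exists (Tuple sz); rewrite /= uc' eqxx.
Qed.

(** Along an order of nondecreasing labels the absolute differences telescope. *)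
Lemma sorted_path_weight_le (l : T -> nat) (x : T) (s : seq T) :
  (forall u v, u != v -> w u v <= `|l u - l v|%N) ->
  uniq (x :: s) -> path (relpre l leq) x s ->
  l x + sumn (pairmap w x s) <= l (last x s).
Proof.
move=> lP; elim: s x => [|y s IHs] x; first by rewrite addn0.
move=> /andP[xNys uys] /= /andP[lxy ys].
have := IHs y uys ys; have: x != y by apply: contraNneq xNys => ->; rewrite inE eqxx.
by move/lP; lia.
Qed.

Lemma exists_path_weight_le_span (l : T -> nat) :
  (forall u v, u != v -> w u v <= `|l u - l v|%N) ->
  exists2 c, hamiltonian_path c & path_weight w c <= label_span l.
Proof.
move=> lP; pose c := sort (relpre l leq) (enum T).
have uc : uniq c by rewrite sort_uniq enum_uniq.
have sc : sorted (relpre l leq) c by apply: sort_sorted => u v; apply: leq_total.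
exists c; first by split=> // v; rewrite mem_sort mem_enum.
case: c uc sc => //= x s uxs xs.
have := sorted_path_weight_le lP uxs xs.
have := @leq_bigmax_cond _ xpredT l (last x s) isT.
by rewrite /label_span; lia.
Qed.

Lemma labeling_of_path (c : seq T) (a : nat) :
    (forall u v, u != v -> a <= w u v <= a.*2) ->
    (forall u v, u != v -> w u v = w v u) -> 0 < #|T| ->
    hamiltonian_path c ->
  exists2 l : T -> nat, (forall u v, u != v -> w u v <= `|l u - l v|%N)
    & label_span l = path_weight w c.
Proof.
move=> wP wC; case: c => [|x s] cardT [uc inc].
  by case/card_gt0P: cardT => v _; have:= inc v.
pose h i := sumn (take i (pairmap w x s)).
have hS i : i < size s -> h i.+1 = h i + w (nth x (x :: s) i) (nth x s i).
  by move=> lti; rewrite /h (take_nth 0) ?size_pairmap // sumn_rcons (nth_pairmap x).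
have h_le i j : i <= j -> h i <= h j.
  move=> leij; rewrite /h -(subnKC leij) takeD sumn_cat leq_addr //.
pose l v := h (index v (x :: s)).
have lP u v : index u (x :: s) < index v (x :: s) -> w u v <= l v - l u.
  rewrite /l; set i := index u _; set j := index v _ => ltij.
  have ltj : j < size (x :: s) by rewrite index_mem.
  have lti : i < size s by apply: leq_trans ltij _; rewrite -ltnS.
  have lti' : i < size (x :: s) by apply: ltnW.
  have nth_i : nth x (x :: s) i = u by rewrite nth_index.
  have nth_j : nth x (x :: s) j = v by rewrite nth_index.
  have nth_neq i' : i' < size s -> nth x (x :: s) i' != nth x s i'.
    move=> lt'; rewrite -[nth x s i']/(nth x (x :: s) i'.+1) nth_uniq //.
      by rewrite neq_ltn ltnSn.
    exact: ltnW.
  have neq_uv : u != v by rewrite -nth_i -nth_j nth_uniq // neq_ltn ltij.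
  have [eqj|ltij1] := eqVneq j i.+1.
    by rewrite eqj hS ?addKn -?nth_i -?nth_j ?eqj //; rewrite eqj in ltj.
  (* At least two edges of the path separate [u] from [v]; their weights add up to at least [a.*2],
     which bounds [w u v]. *)
  have ltij2 : i.+2 <= j by rewrite ltn_neqAle eq_sym ltij1.
  have := h_le _ _ ltij2; have lti2 : i.+1 < size s by apply: leq_trans ltij2 _.
  rewrite hS // hS ?(ltnW lti2) //.
  have /wP := nth_neq _ lti2; have /wP := nth_neq _ (ltnW lti2).
  by have /wP := neq_uv; lia.
exists l => [u v neq_uv|].
  case: (ltngtP (index u (x :: s)) (index v (x :: s))) => [ltuv|ltvu|eq_uv].
  - by have := lP _ _ ltuv; lia.
  - by rewrite wC //; have := lP _ _ ltvu; lia.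
  - by case/eqP: neq_uv; rewrite -(nth_index x (inc u)) eq_uv nth_index.
(* Labels never decrease along the path, so the span is the label of the last vertex, the weight of
   the whole path. *)
apply/eqP; rewrite eqn_leq; apply/andP; split.
  apply/bigmax_leqP => v _; rewrite /= -[X in _ <= sumn X]take_size.
  by apply: h_le; rewrite size_pairmap -ltnS (index_mem v (x :: s)).
have := @leq_bigmax_cond _ xpredT l (last x s) isT.
by rewrite /l index_last // /h -(size_pairmap w x) take_size.
Qed.

End Metric.

Lemma exists_lambda_min_path_tsp k (p : k.-tuple nat) (T : finType) (e : rel T) :
    (forall u v, dist e u v <= k) ->
    (forall u v, u != v -> pmin p <= dist_weight p e u v <= (pmin p).*2) ->
    (forall u v, u != v -> dist_weight p e u v = dist_weight p e v u) ->
    0 < #|T| ->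
  exists m, is_lambda p e m /\ is_min_path_tsp (dist_weight p e) m.
Proof.
move=> dk wP wC cardT; have [m minm] := exists_min_path_tsp (dist_weight p e).
exists m; split=> //; case: minm => [[c hc <-] min_m]; split.
  by have [l lP <-] := labeling_of_path wP wC cardT hc; exists l => // u v /lP.
move=> s [l lP <-]; have [u v neq|c' hc' le_c'] := @exists_path_weight_le_span _ (dist_weight p e) l.
  exact: lP.
by apply: leq_trans le_c'; apply: min_m; exists c'.
Qed.

Lemma dist_weight_bounds k (p : k.-tuple nat) (T : finType) (e : rel T) :
    pmax p <= 2 * pmin p -> (forall u v, connect e u v) -> diameter e <= k ->
  forall u v, u != v -> pmin p <= dist_weight p e u v <= (pmin p).*2.
Proof.
move=> pP conn dk u v neq.
have dP : 0 < dist e u v <= size p.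
  by rewrite lt0n dist_eq0 // neq size_tuple (leq_trans (dist_diameter e u v)).
by rewrite pmin_le_entry // -mul2n (leq_trans _ pP) // entry_le_pmax.
Qed.

(** * Breadth-first search from several sources *)

Section BFS.
Variables (V : eqType) (E : rel V) (delta : V -> nat).
Hypothesis delta_step : forall x y, E x y -> delta y <= (delta x).+1.
Hypothesis delta_pred :
  forall y, delta y != 0 -> exists2 x, E x y & (delta x).+1 = delta y.

Record bfs_inv (done todo : seq V) : Prop := BfsInv {
  bfs_uniq : uniq (done ++ todo);
  bfs_source : forall x, delta x = 0 -> x \in done ++ todo;
  bfs_closed : forall x y, x \in done -> E x y -> y \in done ++ todo;
  bfs_sorted : sorted leq (map delta (done ++ todo));
  bfs_window : forall x y,
    x \in todo -> y \in done ++ todo -> delta y <= (delta x).+1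
}.

Lemma bfs_todo_min done x todo z :
  bfs_inv done (x :: todo) -> z \in x :: todo -> delta x <= delta z.
Proof.
case=> _ _ _ + _; rewrite map_cat sorted_cat_cons => /andP[_ /=].
rewrite path_sortedE; last exact: leq_trans.
case/andP=> /allP all_ge _; rewrite inE => /predU1P[-> //|z_todo].
exact/all_ge/map_f.
Qed.

(** Induction on the level of [y]. Its predecessor [z] has been discovered and lies strictly below
    [x], the lowest pending vertex; so [z] is in [done], and its out-neighbours are all
    discovered. *)
Lemma bfs_below done x todo y :
  bfs_inv done (x :: todo) -> delta y <= delta x -> y \in done ++ x :: todo.
Proof.
move=> inv; have [n le_n] := ubnP (delta y); elim: n y le_n => // n IHn y le_n le_x.
have [y0|/delta_pred[z Ezy dz]] := eqVneq (delta y) 0; first exact: bfs_source inv _ y0.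
have: z \in done ++ x :: todo by apply: IHn; lia.
rewrite mem_cat => /orP[/(bfs_closed inv)-> // | /(bfs_todo_min inv)]; lia.
Qed.

Lemma bfs_new done x todo y : bfs_inv done (x :: todo) -> E x y ->
  y \notin done ++ x :: todo -> delta y = (delta x).+1.
Proof.
move=> inv Exy; have := delta_step Exy; rewrite leq_eqVlt => /predU1P[// |].
by rewrite ltnS => /(bfs_below inv)->.
Qed.

(** The new vertex has level [(delta x).+1], the highest that the window at [x] allows, so appending
    it keeps the levels sorted. *)
Lemma bfs_push done x todo y : bfs_inv done (x :: todo) -> E x y ->
  y \notin done ++ x :: todo -> bfs_inv done (x :: rcons todo y).
Proof.
move=> inv Exy yN; have dy := bfs_new inv Exy yN.
have memE z : z \in done ++ x :: rcons todo y -> z = y \/ z \in done ++ x :: todo.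
  by rewrite -rcons_cons -rcons_cat mem_rcons inE => /predU1P.
have sub z : z \in done ++ x :: todo -> z \in done ++ x :: rcons todo y.
  by rewrite -rcons_cons -rcons_cat mem_rcons inE => ->; rewrite orbT.
have x_in : x \in done ++ x :: todo by rewrite mem_cat mem_head orbT.
have x_todo := mem_head x todo.
split.
- by rewrite -rcons_cons -rcons_cat rcons_uniq yN (bfs_uniq inv).
- by move=> z /(bfs_source inv)/sub.
- by move=> z t /(bfs_closed inv) H /H /sub.
- rewrite -rcons_cons -rcons_cat map_rcons.
  have := bfs_sorted inv; have: forall z, z \in done ++ x :: todo -> delta z <= delta y.
    by move=> z; rewrite dy; apply: (bfs_window inv).
  case: (done ++ x :: todo) => //= a s le_y sa; rewrite rcons_path sa /= last_map le_y //.
  exact: mem_last.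
- move=> z t; rewrite -rcons_cons mem_rcons inE => z_in /memE t_in.
  have le_z : delta x <= delta z.
    by case/predU1P: z_in => [->|/(bfs_todo_min inv)//]; rewrite dy.
  case: t_in => [->|/(bfs_window inv x_todo)]; lia.
Qed.

Lemma bfs_pop done x todo : bfs_inv done (x :: todo) ->
  (forall y, E x y -> y \in done ++ x :: todo) -> bfs_inv (rcons done x) todo.
Proof.
move=> inv closed; split; rewrite ?cat_rcons.
- exact: bfs_uniq.
- exact: bfs_source.
- move=> z y; rewrite mem_rcons inE => /predU1P[->|/(bfs_closed inv)]; [exact: closed|exact].
- exact: bfs_sorted.
- by move=> z y z_in; apply: (bfs_window inv); rewrite inE z_in orbT.
Qed.

(** With an empty queue, [done] contains the sources and is closed under edges; induction along
    predecessors reaches every vertex. *)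
Lemma bfs_done done y : bfs_inv done [::] -> y \in done.
Proof.
move=> inv; have [n le_n] := ubnP (delta y); elim: n y le_n => // n IHn y le_n.
have [y0|/delta_pred[z Ezy dz]] := eqVneq (delta y) 0.
  by rewrite -[done]cats0 (bfs_source inv).
by rewrite -[done]cats0 (bfs_closed inv _ Ezy) // IHn //; lia.
Qed.

Lemma bfs_init s : uniq s -> (forall x, (x \in s) = (delta x == 0)) -> bfs_inv [::] s.
Proof.
move=> us sE; split=> //= [x dx||x y _].
- by rewrite sE dx.
- have /all_pred1P-> : all (pred1 0) (map delta s).
    by rewrite all_map; apply/allP => x /=; rewrite sE.
  by case: (size _) => //= n; elim: n.
- by rewrite sE => /eqP->.
Qed.
End BFS.

(** * Total correctness with time bounds *)

Definition halts (c : cmd) (s : state) (b : nat) (Q : state -> Prop) : Prop :=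
  exists t s', [/\ exec c s t s', t <= b & Q s'].

Fixpoint loop_free (c : cmd) : bool :=
  match c with
  | Seq c1 c2 | If _ c1 c2 => loop_free c1 && loop_free c2
  | While _ _ => false
  | _ => true
  end.

Fixpoint cost (c : cmd) : nat :=
  match c with
  | Seq c1 c2 => cost c1 + cost c2
  | If _ c1 c2 => (maxn (cost c1) (cost c2)).+1
  | _ => 1
  end.

(** Evaluating loop-free code by a function lets simplification execute it symbolically; loops get a
    dummy value here and are handled by invariants. *)
Fixpoint run (c : cmd) (s : state) : state :=
  match c with
  | Const x v => set_reg s x v
  | Add x y z => set_reg s x (regs s y + regs s z)
  | Defs.Sub x y z => set_reg s x (regs s y - regs s z)
  | Read x a y => set_reg s x (arrs s a (regs s y))
  | Write a x y => set_cell s a (regs s x) (regs s y)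
  | Skip | While _ _ => s
  | Seq c1 c2 => run c2 (run c1 s)
  | If x c1 c2 => if 0 < regs s x then run c1 s else run c2 s
  end.

Lemma exec_run (s : state) (c : cmd) : loop_free c ->
  exists2 t, exec c s t (run c s) & t <= cost c.
Proof.
elim: c s =>  [x v|x y z|x y z|x a y|a x y||c1 IH1 c2 IH2|x c1 IH1 c2 IH2|//] s /=;
  try by eexists; first by constructor.
- case/andP=> /(IH1 s)[t1 e1 le1] /(IH2 (run c1 s))[t2 e2 le2].
  by exists (t1 + t2); [apply: ExecSeq e1 e2 | apply: leq_add].
- case/andP=> /(IH1 s)[t1 e1 le1] /(IH2 s)[t2 e2 le2].
  case: posnP => [x0|x_gt0].
    by exists t2.+1; [apply: ExecIfFalse | lia].
  by exists t1.+1; [apply: ExecIfTrue | lia].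
Qed.

Lemma halts_run c s b (Q : state -> Prop) :
  loop_free c -> cost c <= b -> Q (run c s) -> halts c s b Q.
Proof.
by move=> /(exec_run s)[t e le_t] le_b Qs; exists t, (run c s); split=> //; lia.
Qed.

Lemma halts_weaken c s b b' (Q Q' : state -> Prop) :
  halts c s b Q -> b <= b' -> (forall s', Q s' -> Q' s') -> halts c s b' Q'.
Proof.
by move=> [t [s' [e le_t Qs]]] le_b QQ; exists t, s'; split; [|lia|apply: QQ].
Qed.

Lemma halts_seq c1 c2 s b1 b2 (Q : state -> Prop) :
  halts c1 s b1 (fun s1 => halts c2 s1 b2 Q) -> halts (Seq c1 c2) s (b1 + b2) Q.
Proof.
move=> [t1 [s1 [e1 le1 [t2 [s2 [e2 le2 Qs]]]]]].
by exists (t1 + t2), s2; split=> //; [apply: ExecSeq e1 e2 | lia].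
Qed.

(* The first argument of [I] is a potential that pays for the remaining
   iterations. *)
Lemma halts_while x c (I : nat -> state -> Prop) n s :
    (forall n s, I n s -> 0 < regs s x ->
       exists b n', b + n' < n /\ halts c s b (I n')) ->
    I n s ->
  halts (While x c) s n.+1 (fun s' => regs s' x = 0 /\ exists n', I n' s').
Proof.
move=> body; have [m] := ubnP n; elim: m n s => // m IHm n s le_m In.
have [x0|x_gt0] := posnP (regs s x).
  exists 1, s; split=> //; first exact: ExecWhileFalse.
  by split=> //; exists n.
have [b [n' [lt_n [t [s' [e le_t In']]]]]] := body n s In x_gt0.
have [|t' [s'' [e' le_t' Q]]] := IHm n' s' _ In'; first lia.
by exists (t + t').+1, s''; split=> //; [apply: ExecWhileTrue e e' | lia].
Qed.

(** * The all-pairs distance program *)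

Definition block (cs : seq cmd) : cmd := foldr Seq Skip cs.

(* Registers: 0 = n, 2 = 1, 3 = row base, 4 = queue tail, 5 = loop test,
   6 = cell index, 7 = queue head, 8 = current vertex, 9 = its mark, 10 = edge
   index, 11 = its bound, 12 = weight of the next level, 13 = neighbour, 14 =
   its mark. Arrays: 0, 1, 2 = input, 3 = weights, 4 = marks (1 + distance, or 0
   if not yet reached), 5 and 6 = queue of (row base, vertex). *)

(** One source is enqueued per iteration, so the queue tail in register 4 also serves as the number
    of the source. Queue entries store the row base instead of the source, so that a cell index
    costs one addition and no multiplication. *)
Definition init_body : cmd := block
  [:: Write 5 4 3; Write 6 4 4; Add 6 3 4; Write 4 6 2; Add 3 3 0; Add 4 4 2;
      Defs.Sub 5 0 4].

Definition visit : cmd := block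
  [:: Write 4 6 9; Write 3 6 12; Write 5 4 3; Write 6 4 13; Add 4 4 2].

Definition scan_body : cmd := block
  [:: Read 13 1 10; Add 6 3 13; Read 14 4 6; If 14 Skip visit; Add 10 10 2;
      Defs.Sub 5 11 10].

(** A vertex at distance d has mark d + 1. Subtracting 1 gives d, the position of the entry for
    distance d + 1; adding 1 gives the mark d + 2 of newly reached neighbours. *)
Definition dequeue : cmd := block
  [:: Read 3 5 7; Read 8 6 7; Add 7 7 2; Add 6 3 8; Read 9 4 6; Read 10 0 8;
      Add 8 8 2; Read 11 0 8; Defs.Sub 12 9 2; Read 12 2 12; Add 9 9 2; Defs.Sub 5 11 10].

Definition bfs_body : cmd := Seq dequeue (Seq (While 5 scan_body) (Defs.Sub 5 4 7)).

Definition apsp : cmd :=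
  Seq (block [:: Const 2 1; Defs.Sub 5 0 4])
    (Seq (While 5 init_body) (Seq (Defs.Sub 5 4 7) (While 5 bfs_body))).

(** * Correctness and cost of the program *)

Lemma nth_flatten_sumn (ss : seq (seq nat)) i j : j < size (nth [::] ss i) ->
  nth 0 (flatten ss) (sumn (take i (shape ss)) + j) = nth 0 (nth [::] ss i) j.
Proof.
elim: ss i => [|s ss IHss] [|i] //= ltj; first by rewrite nth_cat add0n ltj.
by rewrite nth_cat -addnA ltnNge leq_addr /= addKn IHss.
Qed.

Section APSP.
Variables (T : finType) (e : rel T) (k : nat) (p : k.-tuple nat) (adj : T -> seq T).
Hypothesis conn : forall u v : T, connect e u v.
Hypothesis adjP : adjacency_lists e adj.

Let n := #|T|.
Let r (v : T) : nat := enum_rank v.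
(** The pair [(s, v)] is the vertex [v] in the copy of source [s]; the sources of the search form
    the diagonal. *)
Let E (x y : T * T) : bool := (x.1 == y.1) && e x.2 y.2.
Let delta (x : T * T) : nat := dist e x.1 x.2.
Let cell (x : T * T) : nat := r x.1 * n + r x.2.
Let offs := offsets adj.
Let flat := flatten (numbered_adjacency adj).

Let r_lt v : r v < n. Proof. exact: ltn_ord. Qed.

(** Quotient and remainder by [n] are unique. Hence a write for one pair leaves the cells of all
    other pairs intact. *)
Let cell_eq x y : (cell x == cell y) = (x == y).
Proof.
apply/eqP/eqP=> [|-> //]; case: x y => [a b] [c d]; rewrite /cell /= => eq_xy.
have := divnMDl (r a) (r b) (leq_ltn_trans (leq0n _) (r_lt a)).
have := modnMDl (r a) (r b) n.
rewrite eq_xy modnMDl divnMDl ?(leq_ltn_trans (leq0n _) (r_lt a)) //.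
rewrite !modn_small ?divn_small // !addn0 => /ord_inj/enum_rank_inj-> /ord_inj/enum_rank_inj->.
by [].
Qed.

Let nth_adj v : nth [::] (numbered_adjacency adj) (r v) = map r (adj v).
Proof.
rewrite (nth_map v); last by rewrite -cardE; apply: r_lt.
by rewrite nth_enum_rank.
Qed.

Let size_numbered : size (numbered_adjacency adj) = n.
Proof. by rewrite size_map -cardE. Qed.

Let nth_offs i : i <= n ->
  nth 0 offs i = sumn (take i (shape (numbered_adjacency adj))).
Proof.
move=> le_i; rewrite /offs /offsets nth_cons_scanl; last first.
  by rewrite size_map size_numbered.
exact: foldl_foldr addnA addnC _ _.
Qed.

Let offs_S v : nth 0 offs (r v).+1 = nth 0 offs (r v) + size (adj v).
Proof.
have lt_v : r v < size (numbered_adjacency adj) by rewrite size_numbered.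
rewrite !nth_offs ?r_lt ?(ltnW (r_lt _)) // (take_nth 0); last by rewrite size_map.
rewrite sumn_rcons.
by rewrite (nth_map [::]) // nth_adj size_map.
Qed.

Let nth_flat v a1 y a2 : adj v = a1 ++ y :: a2 ->
  nth 0 flat (nth 0 offs (r v) + size a1) = r y.
Proof.
move=> adj_v; rewrite nth_offs ?(ltnW (r_lt _)) // nth_flatten_sumn nth_adj adj_v.
  by rewrite map_cat nth_cat size_map ltnn subnn.
by rewrite size_map size_cat /=; lia.
Qed.

(** Here [q] is every pair ever enqueued: dequeuing only advances the head, so [q] is exactly the
    set of marked pairs. Sources have [delta] zero, which exempts the diagonal from the weight
    condition. *)
Record encodes (s : state) (q : seq (T * T)) : Prop := Encodes {
  enc_n : regs s 0 = n;
  enc_1 : regs s 2 = 1;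
  enc_tail : regs s 4 = size q;
  enc_offs : arrs s 0 =1 nth 0 offs;
  enc_flat : arrs s 1 =1 nth 0 flat;
  enc_p : arrs s 2 =1 nth 0 p;
  enc_weight : forall x, x \in q -> delta x != 0 -> arrs s 3 (cell x) = entry p (delta x);
  enc_mark : forall x, arrs s 4 (cell x) = if x \in q then (delta x).+1 else 0;
  enc_base : arrs s 5 =1 nth 0 [seq r x.1 * n | x <- q];
  enc_vertex : arrs s 6 =1 nth 0 [seq r x.2 | x <- q]
}.

Lemma encodes_same s s' q : encodes s q -> arrs s' = arrs s ->
  regs s' 0 = regs s 0 -> regs s' 2 = regs s 2 -> regs s' 4 = regs s 4 -> encodes s' q.
Proof. by case=> ? ? ? ? ? ? ? ? ? ? eA e0 e2 e4; split; rewrite ?eA ?e0 ?e2 ?e4. Qed.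

Lemma encodes_visit s q y d :
    encodes s q -> y \notin q -> delta y = d.+1 ->
    regs s 3 = r y.1 * n -> regs s 13 = r y.2 -> regs s 6 = cell y ->
    regs s 9 = d.+2 -> regs s 12 = nth 0 p d ->
  encodes (run visit s) (rcons q y).
Proof.
move=> ms yN dy s3 s13 s6 s9 s12; split=> //=.
- exact: enc_n ms.
- exact: enc_1 ms.
- by rewrite (enc_tail ms) (enc_1 ms) size_rcons addn1.
- exact: enc_offs ms.
- exact: enc_flat ms.
- exact: enc_p ms.
- move=> x; rewrite mem_rcons inE s6 cell_eq s12.
  by case: eqP => [-> _ _|_ /= /(enc_weight ms) H /H //]; rewrite dy.
- move=> x; rewrite mem_rcons inE s6 cell_eq s9.
  by case: eqP => [->|_ /=]; rewrite ?dy // (enc_mark ms).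
- move=> i; rewrite map_rcons nth_rcons size_map (enc_tail ms) s3 (enc_base ms).
  by case: ltngtP => // lt_i; rewrite nth_default // size_map ltnW.
- move=> i; rewrite map_rcons nth_rcons size_map (enc_tail ms) s13 (enc_vertex ms).
  by case: ltngtP => // lt_i; rewrite nth_default // size_map ltnW.
Qed.

Let delta_step x y : E x y -> delta y <= (delta x).+1.
Proof. by case: x y => [a b] [c d] /andP[/eqP/= <- ebd]; apply: dist_step. Qed.

Let delta_pred y : delta y != 0 -> exists2 x, E x y & (delta x).+1 = delta y.
Proof.
by case: y => a b /(dist_pred conn)[c ecb dc]; exists (a, c); rewrite /E ?eqxx.
Qed.


Let mem_adj u v : (v \in adj u) = e u v.
Proof. by have [_ ->] := adjP u. Qed.

Let scan_cost := (cost scan_body).+1.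

(** The neighbours in [l1] are scanned, those in [l2] remain. During the scan [x] still counts as
    pending although the head register has already passed it, hence [(size done).+1]. *)
Definition scan_inv (done : seq (T * T)) (x : T * T) (pot : nat) (s : state) : Prop :=
  exists todo l1 l2,
  [/\ encodes s (done ++ x :: todo) /\ bfs_inv E delta done (x :: todo),
      adj x.2 = l1 ++ l2 /\ (forall y, y \in l1 -> (x.1, y) \in done ++ x :: todo),
      [/\ regs s 3 = r x.1 * n, regs s 7 = (size done).+1, regs s 9 = (delta x).+2
        & regs s 12 = nth 0 p (delta x)],
      [/\ regs s 10 = nth 0 offs (r x.2) + size l1,
          regs s 11 = nth 0 offs (r x.2) + size (adj x.2) & regs s 5 = size l2]
    & pot = scan_cost * size l2].

Lemma scan_body_correct done x pot s : scan_inv done x pot s -> 0 < regs s 5 ->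
  exists b pot', b + pot' < pot /\ halts scan_body s b (scan_inv done x pot').
Proof.
move=> [todo [l1 [[|y l2]]]] [[ms inv] [adj_x l1_in] [s3 s7 s9 s12] [s10 s11 s5] ->].
  by rewrite s5.
move=> _; exists (cost scan_body), (scan_cost * size l2); split.
  by rewrite /scan_cost /=; lia.
apply: halts_run => //.
have Exy : E x (x.1, y).
  by rewrite /E eqxx /= -mem_adj adj_x mem_cat mem_head orbT.
have s13 : arrs s 1 (regs s 10) = r y by rewrite (enc_flat ms) s10 (nth_flat adj_x).
have s6 : regs s 3 + arrs s 1 (regs s 10) = cell (x.1, y) by rewrite s13 s3.
have adj_x' : adj x.2 = rcons l1 y ++ l2 by rewrite cat_rcons.
have s14 : arrs s 4 (regs s 3 + arrs s 1 (regs s 10)) =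
    if (x.1, y) \in done ++ x :: todo then (delta (x.1, y)).+1 else 0.
  by rewrite s6 (enc_mark ms).
have s5' : nth 0 offs (r x.2) + size (adj x.2) -
    (nth 0 offs (r x.2) + size l1 + 1) = size l2.
  by rewrite adj_x size_cat /=; lia.
rewrite /scan_body /=; have [y_in|yN] := boolP ((x.1, y) \in done ++ x :: todo).
  rewrite s14 y_in /=.
  exists todo, (rcons l1 y), l2; split=> //=.
  - by split=> //; apply: encodes_same ms _ _ _ _.
  - split=> // z; rewrite mem_rcons inE => /predU1P[->|/l1_in] //.
  - by rewrite size_rcons s10 s11 (enc_1 ms) s5'; split=> //; lia.
rewrite s14 (negPf yN) /=.
exists (rcons todo (x.1, y)), (rcons l1 y), l2.
have dy := bfs_new delta_step delta_pred inv Exy yN.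
have q_eq : done ++ x :: rcons todo (x.1, y) = rcons (done ++ x :: todo) (x.1, y).
  by rewrite rcons_cat.
split=> //=.
- split; last exact: (bfs_push delta_step delta_pred inv Exy yN).
  (* [s'] is the state just before [visit]; the instructions after [visit] change only scratch
     registers. *)
  pose s' := run (block [:: Read 13 1 10; Add 6 3 13; Read 14 4 6]) s.
  rewrite q_eq; apply: (@encodes_same (run visit s')); rewrite /= ?s14 ?(negPf yN) //.
  by apply: (@encodes_visit s' _ _ (delta x)) => //; apply: encodes_same ms _ _ _ _.
- split=> // z; rewrite q_eq !mem_rcons !inE => /predU1P[->|/l1_in ->]; first by rewrite eqxx.
  by rewrite orbT.
- by rewrite size_rcons s10 s11 (enc_1 ms) s5'; split=> //; lia.
Qed.

(** The summand 3 pays for the failing test that ends the scan, the update of register 5 and the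
    test of the outer loop; [scan_cost] includes the inner loop test. *)
Let work (x : T * T) := cost dequeue + scan_cost * size (adj x.2) + 3.

Definition bfs_loop_inv (pot : nat) (s : state) : Prop :=
  exists done todo,
  [/\ encodes s (done ++ todo), bfs_inv E delta done todo, regs s 7 = size done,
      regs s 5 = size todo & pot = \sum_(x | x \notin done) work x].

Lemma bfs_body_correct pot s : bfs_loop_inv pot s -> 0 < regs s 5 ->
  exists b pot', b + pot' < pot /\ halts bfs_body s b (bfs_loop_inv pot').
Proof.
move=> [done [[|x todo] [ms inv s7 s5 ->]]]; first by rewrite s5.
move=> _; exists (cost dequeue + ((scan_cost * size (adj x.2)).+1 + 1)).
exists (\sum_(y | y \notin rcons done x) work y).
have x_done : x \notin done.
  by have := bfs_uniq inv; rewrite cat_uniq /= negb_or => /and3P[_ /andP[]].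
split.
  have -> : \sum_(y | y \notin done) work y = work x + \sum_(y | y \notin rcons done x) work y.
    rewrite (bigD1 x x_done); congr (_ + _); apply: eq_bigl => y.
    by rewrite mem_rcons inE negb_or andbC.
  by rewrite [work x]/work; lia.
have s3' : arrs s 5 (regs s 7) = r x.1 * n.
  by rewrite (enc_base ms) s7 map_cat nth_cat size_map ltnn subnn.
have s8' : arrs s 6 (regs s 7) = r x.2.
  by rewrite (enc_vertex ms) s7 map_cat nth_cat size_map ltnn subnn.
have s9' : arrs s 4 (r x.1 * n + r x.2) = (delta x).+1.
  by rewrite (enc_mark ms) mem_cat mem_head orbT.
have inv0 : scan_inv done x (scan_cost * size (adj x.2)) (run dequeue s).
  exists todo, [::], (adj x.2).
  rewrite /= s3' s8' (enc_1 ms) s9' s7 !(enc_offs ms) (enc_p ms) !addn1 subn1 addn0.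
  by rewrite offs_S addKn; split=> //; split=> //; apply: encodes_same ms _ _ _ _.
apply/halts_seq/halts_run => //; apply: halts_seq.
apply: (halts_weaken (halts_while (@scan_body_correct done x) inv0)) => // s'.
case=> s'5 [pot' [todo' [l1 [[|y l2] [[ms' inv'] [adj_x l1_in] [_ s'7 _ _] [_ _ s'5' _]]]]]].
  apply: halts_run => //; exists (rcons done x), todo'; rewrite cat_rcons /=.
  split=> //.
  - exact: encodes_same ms' _ _ _ _.
  - apply: bfs_pop inv' _ => -[a b] /andP[/eqP/= <-].
    by rewrite -mem_adj adj_x cats0; apply: l1_in.
  - by rewrite size_rcons.
  - by rewrite (enc_tail ms') s'7 size_cat /=; lia.
by rewrite s'5 in s'5'.
Qed.

Let sources (i : nat) : seq (T * T) := [seq (v, v) | v <- take i (enum T)].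

Let init_cost := (cost init_body).+1.

Definition init_inv (pot : nat) (s : state) : Prop :=
  exists i, [/\ i <= n, encodes s (sources i), regs s 3 = i * n, regs s 5 = n - i /\ regs s 7 = 0
    & pot = init_cost * (n - i)].

Lemma init_body_correct pot s : init_inv pot s -> 0 < regs s 5 ->
  exists b pot', b + pot' < pot /\ halts init_body s b (init_inv pot').
Proof.
move=> [i [_ ms s3 [s5 s7] ->]]; rewrite s5 subn_gt0 => lt_i.
exists (cost init_body), (init_cost * (n - i.+1)); split.
  by rewrite /init_cost /=; lia.
have lt_iE : i < size (enum T) by rewrite -cardE.
have size_src : size (sources i) = i by rewrite size_map size_take lt_iE.
pose v := enum_val (Ordinal lt_i).
have r_v : r v = i by rewrite /r enum_valK.
have nth_v : nth v (enum T) i = v by rewrite -[X in nth _ _ X]r_v /r nth_enum_rank.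
have src_S : sources i.+1 = rcons (sources i) (v, v).
  by rewrite /sources (take_nth v) // map_rcons nth_v.
have d0 u : delta (u, u) = 0 by apply: dist_xx.
have s4 : regs s 4 = i by rewrite (enc_tail ms).
have s6 : regs s 3 + regs s 4 = cell (v, v) by rewrite s3 s4 /cell /= r_v.
apply: halts_run => //; exists i.+1; split=> //=; last first.
- by rewrite (enc_n ms) s4 (enc_1 ms) addn1.
- by rewrite s3 (enc_n ms) mulSn addnC.
rewrite src_S; split=> //=.
- exact: enc_n ms.
- exact: enc_1 ms.
- by rewrite size_rcons size_src s4 (enc_1 ms) addn1.
- exact: enc_offs ms.
- exact: enc_flat ms.
- exact: enc_p ms.
- by move=> x; rewrite -src_S => /mapP[u _ ->]; rewrite d0.
- move=> x; rewrite s6 mem_rcons inE cell_eq (enc_1 ms).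
  by case: eqP => [->|_ /=]; rewrite ?d0 // (enc_mark ms).
- move=> j; rewrite map_rcons nth_rcons size_map (enc_tail ms) s3 /= r_v (enc_base ms).
  by case: ltngtP => // lt_j; rewrite nth_default // size_map ltnW.
- move=> j; rewrite map_rcons nth_rcons size_map s4 size_src /= r_v (enc_vertex ms).
  by case: ltngtP => // lt_j; rewrite nth_default // size_map size_src ltnW.
Qed.

Lemma apsp_correct :
  halts apsp (input p adj)
    (init_cost * n + n * (n * (cost dequeue + 3) + scan_cost * \sum_(v : T) size (adj v)) + 8)
    (fun s => outputs s (dist_weight p e)).
Proof.
have init0 : init_inv (init_cost * n) (run (block [:: Const 2 1; Defs.Sub 5 0 4]) (input p adj)).
  exists 0; rewrite /sources take0 /= mul0n subn0; split=> //; split=> //= x.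
  by rewrite nth_nil.
(* [work] depends only on the second component, so all [n] copies contribute equally. *)
have work_sum : \sum_(x : T * T) work x =
    n * (n * (cost dequeue + 3) + scan_cost * \sum_(v : T) size (adj v)).
  pose g v := cost dequeue + scan_cost * size (adj v) + 3.
  have -> : \sum_(x : T * T) work x = \sum_(u : T) \sum_(v : T) g v.
    by rewrite pair_bigA; apply: eq_bigr.
  rewrite sum_nat_const -/n; congr (_ * _).
  rewrite -[n * _]sum_nat_const big_distrr -big_split; apply: eq_bigr => v _.
  by rewrite /g /=; lia.
apply: (@halts_weaken _ _ (3 + ((init_cost * n).+1 + (1 + (\sum_(x : T * T) work x).+1)))
  _ _ _ _ _ (fun s H => H)); last by rewrite work_sum; lia.
apply/halts_seq/halts_run => //; apply: halts_seq.
apply: (halts_weaken (halts_while init_body_correct init0)) => // s [s5 [_ [i [le_i ms _ [s5' s7] _]]]].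
(* The loop stopped because register 5, which holds [n - i], reached 0. *)
have eq_i : i = n by apply/eqP; rewrite eqn_leq le_i -subn_eq0 -s5' s5.
have src_i : sources i = [seq (v, v) | v <- enum T].
  by rewrite /sources eq_i /n cardE take_size.
apply/halts_seq/halts_run => //.
have loop0 : bfs_loop_inv (\sum_(x : T * T) work x) (run (Defs.Sub 5 4 7) s).
  exists [::], (sources i); split=> //=.
  - exact: encodes_same ms _ _ _ _.
  - rewrite src_i; apply: bfs_init => [|[u v]].
      by rewrite map_inj_uniq ?enum_uniq // => u v [].
    rewrite /delta /= dist_eq0 //; apply/mapP/eqP => [[w _ [-> ->]] //|->].
    by exists v; rewrite ?mem_enum.
  - by rewrite (enc_tail ms) s7 subn0.
apply: (halts_weaken (halts_while bfs_body_correct loop0)) => // s'.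
case=> s'5 [_ [done [[|x todo] [ms' inv _ s'5' _]]]]; last by rewrite s'5 in s'5'.
move=> u v neq_uv.
have uv_done := bfs_done delta_pred (u, v) inv.
rewrite -[_ * _ + _]/(cell (u, v)) (enc_weight ms') ?cats0 //.
by rewrite /delta /= dist_eq0.
Qed.
End APSP.

(** * Degree sums and the final bound *)

Lemma sum_degree_le (T : finType) (e : rel T) (adj : T -> seq T) :
  adjacency_lists e adj -> \sum_(v : T) size (adj v) <= 2 * #|edges e|.
Proof.
move=> adjP; pose A := [set x : T * T | e x.1 x.2].
have -> : \sum_(v : T) size (adj v) = #|A|.
  rewrite -sum1_card (eq_bigl (fun x : T * T => true && e x.1 x.2)); last by move=> x; rewrite inE.
  rewrite -(pair_big_dep xpredT (fun u v => e u v) (fun _ _ => 1)) /=; apply: eq_bigr => v _.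
  by have [u_adj adj_v] := adjP v; rewrite sum1_card -(card_uniqP u_adj); apply: eq_card.
(* Ordered adjacent pairs are grouped by the edge they span; the group of the edge on a and b lies
   in {(a, b), (b, a)}. *)
rewrite -sum1_card (partition_big (fun x : T * T => [set x.1; x.2]) (fun D => D \in edges e)) /=; last first.
  by move=> x; rewrite inE => exy; apply/imsetP; exists x; rewrite ?inE.
rewrite mulnC -sum_nat_const; apply: leq_sum => D /imsetP[[a b] _ ->] /=.
rewrite sum1_card; apply: (@leq_trans #|[set (a, b); (b, a)]|); last by rewrite cards2; case: eqP.
apply/subset_leq_card/subsetP => -[c d]; rewrite !inE /= => /andP[_ /eqP eq_ab].
have: c \in [set a; b] by rewrite -eq_ab !inE eqxx.
have: d \in [set a; b] by rewrite -eq_ab !inE eqxx orbT.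
have: a \in [set c; d] by rewrite eq_ab !inE eqxx.
have: b \in [set c; d] by rewrite eq_ab !inE eqxx orbT.
rewrite !inE !xpair_eqE.
by do 4![case/orP=> /eqP ?]; subst; rewrite ?eqxx ?orbT.
Qed.

(** Every vertex has a neighbour, namely the first step of a path to some other vertex. This lets
    the quadratic term of the running time be absorbed into n m. *)
Lemma card_le_sum_degree (T : finType) (e : rel T) (adj : T -> seq T) :
    (forall u v, connect e u v) -> adjacency_lists e adj -> 1 < #|T| ->
  #|T| <= \sum_(v : T) size (adj v).
Proof.
move=> conn adjP gt1; rewrite -sum1_card; apply: leq_sum => u _.
have /card_gt1P[x [y [_ _ neq_xy]]] : 1 < #|predT : pred T| by [].
have [v neq_uv] : exists v, u != v.
  by have [eq_ux|] := eqVneq u x; [exists y; rewrite eq_ux | exists x].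
case/connectP: (conn u v) neq_uv => -[_ ->|z s /= /andP[euz _] _ _]; first by rewrite eqxx.
have: z \in adj u by have [_ ->] := adjP u.
by case: (adj u).
Qed.

(* The bound C * (n * m + 1) is O(n m) as soon as n >= 2; the + 1 only
   accounts for the one-vertex graph, for which n * m = 0. *)
Theorem theorem2 :
  exists (prog : cmd) (C : nat),
  forall (k : nat) (p : k.-tuple nat) (T : finType) (e : rel T),
    1 <= k -> pmax p <= 2 * pmin p ->
    simple_graph e -> connected_graph e -> diameter e <= k ->
    [/\ forall adj : T -> seq T, adjacency_lists e adj ->
          exists (t : nat) (s : state),
            [/\ exec prog (input p adj) t s,
                outputs s (dist_weight p e)
              & t <= C * (#|T| * #|edges e| + 1)],
        weighted_complete_graph (dist_weight p e),
        triangle_inequality (dist_weight p e)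
      & exists lambda : nat,
          is_lambda p e lambda /\ is_min_path_tsp (dist_weight p e) lambda].
Proof.
(* The program spends 9 steps per source, 16 per dequeued pair and 14 per scanned neighbour. With n
   <= 2m and degree sum at most 2m this is at most 78 n m + 8, so 200 leaves slack. *)
exists apsp, 200 => k p T e k_gt0 pP [sym _] [T_gt0 conn] dk.
have wC : forall u v, u != v -> dist_weight p e u v = dist_weight p e v u.
  by move=> u v _; rewrite /dist_weight dist_sym.
have wP := dist_weight_bounds pP conn dk.
split=> //.
- move=> adj adjP; have [t [s [ex le_t out]]] := apsp_correct p conn adjP.
  exists t, s; split=> //; apply: leq_trans le_t _.
  have := sum_degree_le adjP; set d := \sum_(v : T) _; set m := #|edges e| => le_d.
  have [gt1|le1] := ltnP 1 #|T|; last first.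
    have -> : #|T| = 1 by lia.
    by rewrite /=; lia.
  have le_nm : #|T| <= 2 * m by apply: leq_trans le_d; apply: card_le_sum_degree.
  have := leq_mul (leqnn #|T|) le_nm; have := leq_mul (leqnn #|T|) le_d.
  have := leq_pmulr #|T| T_gt0.
  by rewrite mulnDr !(mulnCA #|T|) /=; lia.
- by move=> u v x /wP/andP[_ le_uv] /wP/andP[le_ux _] vx; have /wP := vx; rewrite wC //; lia.
- apply: exists_lambda_min_path_tsp => // u v.
  exact: leq_trans (dist_diameter e u v) dk.
Qed.
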